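(* Let $a,b,d$ be three pairwise coprime positive integers such that $d\notin\langle a,b\rangle$, and let $S=\langle a,b\rangle/d$. Then $t(S)<e(S)$. Consequently $S$ satisfies Wilf's property: $$\frac{g(S)}{f(S)+1}\leqslant 1-\frac{1}{e(S)}.$$
   Context: $\langle a,b\rangle=\{xa+yb: x,y\in\mathbb{N}\}$. For a numerical semigroup $S$ (a cofinite submonoid of $(\mathbb{N},+)$) and a positive integer $d$, $S/d=\{x\in\mathbb{N}: dx\in S\}$, which is a numerical semigroup. For a numerical semigroup $S$: $\mathrm{Irr}(S)$ is the set of nonzero elements of $S$ that are not a sum of two nonzero elements of $S$ (the minimal generating set), and the embedding dimension is $e(S)=\#\mathrm{Irr}(S)$; $\mathrm{PF}(S)$ (pseudo-Frobenius numbers) is the set of $x\in\mathbb{Z}\setminus S$ such that $x+s\in S$ for every nonzero $s\in S$, and the type is $t(S)=\#\mathrm{PF}(S)$; $g(S)=\#(\mathbb{N}\setminus S)$ is the genus and $f(S)=\max(\mathbb{Z}\setminus S)$ is the Frobenius number. *)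

(* Defs.v *)
From HB Require Import structures.
From mathcomp Require Import all_boot all_order all_algebra finmap.
From mathcomp Require Import mathcomp_extra boolp classical_sets cardinality.
From mathcomp Require Import zify.

Set Implicit Arguments.
Unset Strict Implicit.
Unset Printing Implicit Defensive.

Import Order.TTheory GRing.Theory Num.Theory.

Local Open Scope classical_set_scope.

(* Cardinal of a finite set; [fset_set] is empty on infinite sets, see the
   finiteness lemmas below. *)
Definition fincard {T : choiceType} (A : set T) : nat := #|` fset_set A|.

Definition numerical_semigroup (S : set nat) : Prop :=
  [/\ S 0%N,
      forall x y, S x -> S y -> S (x + y)%N
    & finite_set (~` S)].

Definition gen2 (a b : nat) : set nat :=
  [set n | exists x y : nat, n = (x * a + y * b)%N].

Definition sgquotient (S : set nat) (d : nat) : set nat :=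
  [set x | S (d * x)%N].

Definition inZ (S : set nat) : set int := Posz @` S.

Definition Irr (S : set nat) : set nat :=
  [set x | [/\ S x, x <> 0%N
    & ~ exists y z : nat,
          [/\ S y, y <> 0%N, S z, z <> 0%N & x = (y + z)%N]]].

Definition PF (S : set nat) : set int :=
  [set x | ~ inZ S x
    /\ forall s : nat, S s -> s <> 0%N -> inZ S (x + s%:Z)%R].

Definition embdim (S : set nat) : nat := fincard (Irr S).

Definition sgtype (S : set nat) : nat := fincard (PF S).

Definition genus (S : set nat) : nat := fincard (~` S).

Definition is_max (A : set int) (m : int) : Prop :=
  A m /\ forall z : int, A z -> (z <= m)%R.

(* The maximum of the integers outside [S]; the default value -1 is never used
   for a numerical semigroup, see [frobeniusP]. *)
Definition frobenius (S : set nat) : int := xget (-1)%R (is_max (~` inZ S)).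

Lemma inZ_Posz (S : set nat) (n : nat) : inZ S (Posz n) <-> S n.
Proof. by split=> [[m Sm [<-]]|Sn] //; exists n. Qed.

Lemma cofinite_bound (S : set nat) :
  finite_set (~` S) -> exists c : nat, forall n, (c <= n)%N -> S n.
Proof.
move=> /finite_seqP[s sE]; exists (\max_(i <- s) i).+1 => n ltn.
apply: contrapT => nSn; have : (~` S) n by [].
rewrite sE /= => ns; move: ltn; rewrite ltnNge => /negP; apply.
exact: (@leq_bigmax_seq _ s predT id n ns).
Qed.

Lemma bound_finite (A : set nat) (c : nat) :
  (forall n, A n -> (n < c)%N) -> finite_set A.
Proof. by move=> Ac; apply: (sub_finite_set _ (finite_II c)) => n /Ac. Qed.

Lemma gen2_numerical_semigroup (a b : nat) :
  (0 < a)%N -> (0 < b)%N -> coprime a b -> numerical_semigroup (gen2 a b).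
Proof.
move=> a0 b0 cab; split; first by exists 0%N, 0%N.
  by move=> _ _ [x [y ->]] [z [t ->]]; exists (x + z)%N, (y + t)%N; lia.
apply: (@bound_finite _ (a * b)) => n; apply: contra_notT; rewrite -leqNgt => abn.
pose m := (chinese a b 0 n %% (a * b))%N.
have mn : (m <= n)%N by rewrite (leq_trans _ abn)// ltnW// ltn_pmod// muln_gt0 a0.
have /dvdnP[x mx] : (a %| m)%N.
  apply/eqP; rewrite /m modn_dvdm ?dvdn_mulr//.
  by rewrite chinese_modl// mod0n.
have /dvdnP[y my] : (b %| n - m)%N.
  rewrite -eqn_mod_dvd// /m modn_dvdm ?dvdn_mull// chinese_modr//.
by exists x, y; rewrite -mx -my subnKC.
Qed.

Lemma sgquotient_numerical_semigroup (S : set nat) (d : nat) :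
  (0 < d)%N -> numerical_semigroup S -> numerical_semigroup (sgquotient S d).
Proof.
move=> d0 [S0 SD /cofinite_bound[c Sc]]; split; rewrite /sgquotient /=.
- by rewrite muln0.
- by move=> x y Sx Sy; rewrite mulnDr; apply: SD.
- apply: (@bound_finite _ c) => n; apply: contra_notT; rewrite -leqNgt => cn.
  by apply: Sc; rewrite (leq_trans cn)// leq_pmull.
Qed.

Lemma finite_Irr (S : set nat) : numerical_semigroup S -> finite_set (Irr S).
Proof.
move=> [_ _ /cofinite_bound[c Sc]]; apply: (@bound_finite _ (c.+1 + c.+1)) => n.
move=> [_ _]; apply: contra_notT; rewrite -leqNgt => cn.
by exists c.+1, (n - c.+1)%N; split; [apply: Sc| |apply: Sc| |]; lia.
Qed.

Lemma finite_PF (S : set nat) : numerical_semigroup S -> finite_set (PF S).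
Proof.
move=> [_ _ /cofinite_bound[c Sc]].
pose f (k : nat) : int := (k%:Z - c.+1%:Z)%R.
apply: (sub_finite_set _ (finite_image f (finite_II (c.+1 + c)))) => x [nSx xS].
have [] := xS c.+1 (Sc _ (leqnSn c)) _; first by [].
move=> k _ kE; exists k; last by rewrite /f kE; lia.
rewrite /= ltnNge; apply/negP => ck; apply: nSx; exists (k - c.+1)%N; last by lia.
by apply: Sc; lia.
Qed.

Lemma frobeniusP (S : set nat) :
  numerical_semigroup S -> is_max (~` inZ S) (frobenius S).
Proof.
move=> [_ _ /cofinite_bound[c Sc]]; apply: xgetPex.
elim: c Sc => [|c IHc] Sc.
  exists (-1)%R; split=> [[n _]|[n|n] nSn]; [by []| |by lia].
  by case: nSn; exists n => //; apply: Sc.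
have [Sn|nSn] := pselect (S c).
  by apply: IHc => n; rewrite leq_eqVlt => /predU1P[<-//|]; apply: Sc.
exists (Posz c); split=> [/inZ_Posz//|[n|n] nS]; last by lia.
rewrite lez_nat leqNgt; apply/negP => cn; apply: nS; exists n => //.
exact: Sc.
Qed.

(* Main.v *)
Require Import Defs.
From mathcomp Require Import all_boot all_order all_algebra finmap.
From mathcomp Require Import boolp classical_sets cardinality.
From mathcomp Require Import zify.

(** By Bezout, S is the projection to the first coordinate of the lattice
    points (s, k) of a plane cone k1 / n1 <= k / s <= k2 / n2. The cone can be
    narrowed, without changing S, until n1 and n2 are irreducible in S and have
    a single lift each, i.e. 0 < n1 k2 - k1 n2 < min(n1, n2).

    Let X and Y be the coordinates that vanish on the two edges. The fibre over
    a pseudo-Frobenius number f misses the cone, by A > 0 on the side X < 0 and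
    by B > 0 on the side Y < 0; that f + s is in S for all nonzero s in S says
    exactly that no nonzero point of the cone has X < A and Y < B. Sending f to
    the irreducible of largest X-coordinate below A is injective and never
    yields n2, so t(S) < e(S).

    Every gap is a pseudo-Frobenius number minus an element of S below the
    Frobenius number f(S), so g(S) <= t(S) n with n = f(S) + 1 - g(S). Hence
    f(S) + 1 <= (t(S) + 1) n <= e(S) n, which is Wilf's inequality. *)

Import Order.TTheory GRing.Theory Num.Theory.
Set Implicit Arguments.
Unset Strict Implicit.
Unset Printing Implicit Defensive.

Local Open Scope classical_set_scope.
Local Open Scope ring_scope.

(** * Finite cardinals and irreducible summands *)

Lemma leq_fincard_rel (T U : choiceType) (A : set T) (B : set U)
    (r : T -> U -> Prop) :
  finite_set A -> finite_set B ->
  (forall x, A x -> exists2 y, B y & r x y) ->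
  (forall x x' y, A x -> A x' -> r x y -> r x' y -> x = x') ->
  (fincard A <= fincard B)%N.
Proof.
move=> finA finB rB r_inj.
have [->|/set0P[x0 Ax0]] := eqVneq A set0.
  by rewrite /fincard fset_set0 cardfs0.
have [y0 By0 _] := rB _ Ax0.
have /choice[f fP] : forall x, exists y, A x -> B y /\ r x y.
  move=> x; have [/rB[y By rxy]|nAx] := pselect (A x); first by exists y.
  by exists y0.
have f_inj : {in fset_set A &, injective f}.
  move=> x x'; rewrite !in_fset_set// !inE => Ax Ax' fxx'.
  apply: (r_inj x x' (f x)) => //; first by case: (fP x Ax).
  by rewrite fxx'; case: (fP x' Ax').
rewrite /fincard -(card_in_imfset imfset_key f_inj).
apply/fsubset_leq_card/fsubsetP => _ /imfsetP[x /= xA ->].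
by move: xA; rewrite !in_fset_set// !inE => /fP[].
Qed.

Lemma finite_argmin (T : choiceType) (disp : Order.disp_t)
    (O : orderType disp) (A : set T) (g : T -> O) (x0 : T) :
  finite_set A -> A x0 ->
  exists2 m, A m & forall x, A x -> (g m <= g x)%O.
Proof.
move=> /finite_fsetP[B ->] Bx0; pose x1 : B := [` Bx0]%fset.
pose m := [arg min_(i < x1) g (val i)]%O.
exists (val m); first exact: valP.
move=> x Bx; rewrite /m; case: arg_minP => //= i _ /(_ [` Bx]%fset).
exact.
Qed.

Lemma leq_fincardX (T U : choiceType) (A : set T) (B : set U) :
  finite_set A -> finite_set B ->
  (fincard (A `*` B) <= fincard A * fincard B)%N.
Proof.
move=> finA finB; rewrite /fincard -(size_allpairs pair).
apply: uniq_leq_size => [|[x y]]; first exact: fset_uniq.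
rewrite in_fset_set; last exact: finite_setX.
by rewrite inE => -[/= Ax By]; apply: allpairs_f; rewrite in_fset_set ?inE.
Qed.

Lemma irreducible_summand (S : set nat) (s : nat) :
  numerical_semigroup S -> S s -> s <> 0%N ->
  exists h s' : nat, [/\ Irr S h, S s' & s = (h + s')%N].
Proof.
move=> [S0 SD _]; elim/ltn_ind: s => s IHs Ss s0.
have [[y [z [Sy y0 Sz z0 sE]]]|nred] := pselect (exists y z : nat,
  [/\ S y, y <> 0%N, S z, z <> 0%N & s = (y + z)%N]); last first.
  by exists s, 0%N; split=> //; rewrite addn0.
have [h [t [irrh St yE]]] := IHs y ltac:(lia) Sy y0.
by exists h, (t + z)%N; split=> //; [exact: SD | rewrite addnA -yE].
Qed.

(* Lattice points (s, k) of the plane cone k1 / n1 <= k / s <= k2 / n2,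
   projected to s. *)
Definition cone (n1 k1 n2 k2 : int) : set nat :=
  [set s : nat | exists k : int, k1 * s%:Z <= n1 * k /\ n2 * k <= k2 * s%:Z].

Lemma floorP (n m : int) : 0 < n -> n * (m %/ n)%Z <= m < n * ((m %/ n)%Z + 1).
Proof.
move=> n0; rewrite mulrC lez_floor ?lt0r_neq0//= mulrC.
by rewrite ltz_ceil.
Qed.

(** * Type of a semigroup with a thin cone *)

Section ThinCone.
Variables (S : set nat) (n1 n2 : nat) (k1 k2 : int).
Hypotheses (nsS : numerical_semigroup S) (SE : S = cone n1 k1 n2 k2).
Hypotheses (irr1 : Irr S n1) (irr2 : Irr S n2).
Let D : int := n1%:Z * k2 - k1 * n2%:Z.
Hypotheses (D_gt0 : 0 < D) (Dn1 : D < n1%:Z) (Dn2 : D < n2%:Z).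

(* X and Y are the coordinates that cut out the cone, so a lift of s to the
   cone is an integer k with X s k and Y s k both nonnegative. *)
Let X (s k : int) := n1%:Z * k - k1 * s.
Let Y (s k : int) := k2 * s - n2%:Z * k.
Let lift (s : int) : int := (k2 * s %/ n2%:Z)%Z.
(* An integer f is a gap iff A f > 0: then the fibre over f jumps across the
   cone between lift f and lift f + 1, and B f > 0 always holds. *)
Let A (f : int) := - X f (lift f).
Let B (f : int) := - Y f (lift f + 1).

(** Cramer's rule: since [D] > 0, nonnegative [X] and [Y] force s >= 0. *)
Lemma XYD s k : n2%:Z * X s k + n1%:Z * Y s k = D * s.
Proof. by rewrite /X /Y /D; lia. Qed.

Lemma liftP s : 0 <= Y s (lift s) < n2%:Z.
Proof.
have n20 : 0 < n2%:Z by move: D_gt0 Dn2; lia.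
have := floorP (k2 * s) n20.
rewrite /Y /lift; lia.
Qed.

Lemma XY_mem s k : 0 <= X s%:Z k -> 0 <= Y s%:Z k -> S s.
Proof. by rewrite SE /X /Y => X0 Y0; exists k; lia. Qed.

Lemma XY_ge0 s k : 0 <= X s k -> 0 <= Y s k -> 0 <= s.
Proof.
move=> X0 Y0; have := XYD s k => E.
have : 0 <= D * s by rewrite -E addr_ge0 ?mulr_ge0.
by rewrite pmulr_rge0.
Qed.

Lemma XY_gt0 s k : 0 <= X s k -> 0 < Y s k -> 0 < s.
Proof.
move=> X0 Y0; rewrite -(pmulr_rgt0 _ D_gt0) -(XYD s k).
by apply: ltr_wpDl; [exact: mulr_ge0 | apply: mulr_gt0 => //; lia].
Qed.

Lemma mem_X_lift (s : nat) : S s -> 0 <= X s (lift s).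
Proof.
rewrite {1}SE => -[k [h1 h2]]; have := liftP s%:Z; rewrite /X /Y => /andP[_ h3].
have : k < lift s + 1.
  rewrite -(@ltr_pM2l _ n2%:Z); [lia | move: D_gt0 Dn2; lia].
move=> kl; have : n1%:Z * k <= n1%:Z * lift s by apply: ler_wpM2l; lia.
lia.
Qed.

(** A lift of f + s is either at most [lift f + k], and [X] >= 0 there gives the first case, or at
    least [lift f + k + 1], and [Y] >= 0 gives the second. *)
Lemma PF_box f (s : nat) k : PF S f -> s <> 0%N ->
  0 <= X s k -> 0 <= Y s k -> A f <= X s k \/ B f <= Y s k.
Proof.
move=> [_ fP] s0 X0 Y0; have [t St tE] := fP s (XY_mem X0 Y0) s0.
move: St; rewrite {1}SE => -[k' []]; rewrite tE => h1 h2.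
rewrite /A /B /X /Y; have [le|lt] := lerP k' (lift f + k).
  left; have : n1%:Z * k' <= n1%:Z * (lift f + k) by apply: ler_wpM2l; lia.
  lia.
right; have : n2%:Z * (lift f + k + 1) <= n2%:Z * k' by apply: ler_wpM2l; lia.
lia.
Qed.

Lemma PF_gt0 f : PF S f -> 0 < A f /\ 0 < B f.
Proof.
move=> [nSf fP]; have := liftP f => /andP[Y0 Y1].
split; last by move: Y1; rewrite /B /Y; lia.
rewrite ltNge; apply/negP => A0; apply: nSf.
have X0 : 0 <= X f (lift f) by move: A0; rewrite /A; lia.
case: f {fP Y1 A0} X0 Y0 (XY_ge0 X0 Y0) => // f X0 Y0 _.
by apply/inZ_Posz; apply: XY_mem X0 Y0.
Qed.

(** Otherwise [lift f - lift f'] would place f - f' in the cone, as a nonzero point inside the box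
    of f'. *)
Lemma PF_antichain f f' :
  PF S f -> PF S f' -> A f <= A f' -> B f <= B f' -> f = f'.
Proof.
move=> Pf Pf' AA BB; have [A0 B0] := PF_gt0 Pf.
have X0 : 0 <= X (f - f') (lift f - lift f') by move: AA; rewrite /A /X; lia.
have Y0 : 0 <= Y (f - f') (lift f - lift f') by move: BB; rewrite /B /Y; lia.
have [s sE] : exists s : nat, f - f' = s%:Z.
  by have := XY_ge0 X0 Y0; case: (f - f') => // s _; exists s.
have [s0|s0] := eqVneq s 0%N; first by lia.
rewrite sE in X0 Y0.
have [] := PF_box Pf' (elimN eqP s0) X0 Y0; rewrite -sE.
  by move: A0; rewrite /A /X; lia.
by move: B0; rewrite /B /Y; lia.
Qed.

Lemma X_n1 : X n1 (lift n1) = 0.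
Proof.
have /andP[h0 h1] := liftP n1.
have lk : lift n1 = k1.
  apply/eqP; rewrite eq_le; apply/andP; split.
  - rewrite -ltzD1 -(@ltr_pM2l _ n2%:Z); last by move: D_gt0 Dn2; lia.
    by move: h0 Dn2; rewrite /Y /D; lia.
  - rewrite -ltzD1 -(@ltr_pM2l _ n2%:Z); last by move: D_gt0 Dn2; lia.
    by move: h1 D_gt0; rewrite /Y /D; lia.
by rewrite /X lk; lia.
Qed.

Lemma lift_n2 : lift n2 = k2.
Proof. by rewrite /lift mulzK //; move: D_gt0 Dn2; lia. Qed.

(** The lift [k2] of n2 has [X] = [D] and [Y] = 0 < [B f], so [PF_box] leaves only this case. *)
Lemma PF_A_le_D f : PF S f -> A f <= D.
Proof.
move=> Pf; have [A0 B0] := PF_gt0 Pf.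
have [] := @PF_box f n2 k2 Pf; rewrite /X /Y /D; [|lia|lia|lia|lia].
by case: irr2.
Qed.

(** Lowering k by 1 lowers [X] by n1; raising it lowers [Y] by n2. *)
Lemma lift_unique (s : nat) k k' : X s k < n1%:Z -> Y s k < n2%:Z ->
  0 <= X s k' -> 0 <= Y s k' -> k' = k.
Proof.
rewrite /X /Y => h1 h2 h3 h4; apply/eqP; rewrite eq_le; apply/andP; split.
- rewrite -ltzD1 -(@ltr_pM2l _ n2%:Z); [lia | by move: D_gt0 Dn2; lia].
- rewrite -ltzD1 -(@ltr_pM2l _ n1%:Z); [lia | by move: D_gt0 Dn1; lia].
Qed.

Definition below f h := [/\ Irr S h, X h (lift h) < A f &
  forall h', Irr S h' -> X h' (lift h') < A f ->
    X h' (lift h') <= X h (lift h)].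

Lemma below_exists f : PF S f -> exists2 h, (Irr S `\ n2) h & below f h.
Proof.
move=> Pf; have [A0 B0] := PF_gt0 Pf.
pose C := [set h | Irr S h /\ X h (lift h) < A f].
have finC : finite_set C.
  by apply: sub_finite_set (finite_Irr nsS) => h [].
have Cn1 : C n1 by split=> //; rewrite X_n1.
have [h [irrh Ah] hmax] :=
  finite_argmin (fun h : nat => - X h (lift h)) finC Cn1.
exists h; last by split=> // h' i' l'; rewrite -lerN2; apply: hmax.
split=> // hE; move: Ah; rewrite {}hE lift_n2 => Ah.
by have := PF_A_le_D Pf; move: Ah; rewrite /X /D; lia.
Qed.

(* If f <> f' shared h, translating the lift of h by the difference of the
   boxes of f and f' would give a point of the cone, hence an irreducible
   below it, which either contradicts the maximality of h or is a summand of h. *)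
Lemma below_inj f f' h : PF S f -> PF S f' -> below f h -> below f' h -> f = f'.
Proof.
wlog : f f' / A f <= A f'.
  move=> wl; have [le|/ltW le] := lerP (A f) (A f'); first exact: wl.
  by move=> *; symmetry; apply: wl.
move=> AA Pf Pf' [irrh hA _] [_ hA' hmax].
have [BB|BB] := lerP (B f) (B f'); first exact: PF_antichain.
have {AA}AA : A f < A f'.
  rewrite lt_neqAle AA andbT; apply/eqP => AA'.
  have E : f' = f by apply: PF_antichain => //; rewrite ?AA' // ltW.
  by rewrite E ltxx in BB.
have [Sh h0 _] := irrh.
have X0 := mem_X_lift Sh; have /andP[Y0 Yn2] := liftP h.
have [] := PF_box Pf h0 X0 Y0; first by rewrite leNgt hA.
move=> Bh; have [A0 B0] := PF_gt0 Pf'.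
pose k := lift h + lift f - lift f'.
have XE : X (h%:Z + f - f') k = X h (lift h) + A f' - A f.
  by rewrite /A /X /k; lia.
have YE : Y (h%:Z + f - f') k = Y h (lift h) + B f' - B f.
  by rewrite /B /Y /k; lia.
have Xv0 : 0 <= X (h%:Z + f - f') k by rewrite XE; lia.
have Yv0 : 0 <= Y (h%:Z + f - f') k by rewrite YE; lia.
have [s sE] : exists s : nat, h%:Z + f - f' = s%:Z.
  by have := XY_ge0 Xv0 Yv0; case: (_ - f') => // s _; exists s.
rewrite sE in XE YE Xv0 Yv0.
have s0 : s <> 0%N by have := XY_gt0 Xv0 ltac:(lia); lia.
have [g [s' [irrg Ss' sgE]]] := irreducible_summand nsS (XY_mem Xv0 Yv0) s0.
have [Sg g0 _] := irrg.
have gX := mem_X_lift Sg; have /andP[gY _] := liftP g.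
have sX := mem_X_lift Ss'; have /andP[sY _] := liftP s'.
(* The coordinates of this point are below n1 and n2, so it is the only lift of s in the cone. *)
have kE : lift g + lift s' = k.
  apply: (@lift_unique s).
  - by have := PF_A_le_D Pf'; rewrite XE; lia.
  - by rewrite YE; lia.
  - by rewrite sgE; move: gX sX; rewrite /X; lia.
  - by rewrite sgE; move: gY sY; rewrite /Y; lia.
have XD : X s k = X g (lift g) + X s' (lift s') by rewrite sgE -kE /X; lia.
have YD : Y s k = Y g (lift g) + Y s' (lift s') by rewrite sgE -kE /Y; lia.
(* Here [X] of g is below [A f'], so h is maximal against g; then h - g lies in the cone and h
   splits. *)
have Xgh := hmax g irrg ltac:(lia).
have Ygh : Y g (lift g) < Y h (lift h) by lia.
have hgX : 0 <= X (h%:Z - g%:Z) (lift h - lift g) by move: Xgh; rewrite /X; lia.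
have hgY : 0 < Y (h%:Z - g%:Z) (lift h - lift g) by move: Ygh; rewrite /Y; lia.
have [r rE] : exists r : nat, h%:Z - g%:Z = r%:Z.
  by have := XY_ge0 hgX (ltW hgY); case: (_ - _) => // r _; exists r.
rewrite rE in hgX hgY.
case: irrh => _ _ []; exists g, r; split=> //.
- exact: XY_mem hgX (ltW hgY).
- by have := XY_gt0 hgX hgY; lia.
- by lia.
Qed.

Lemma sgtype_lt_embdim : (sgtype S < embdim S)%N.
Proof.
have finI := finite_Irr nsS.
rewrite /embdim /fincard (cardfsD1 n2) in_fset_set// mem_set// add1n ltnS.
rewrite -fset_setD1//; apply: (leq_fincard_rel (r := below)).
- exact: finite_PF.
- exact: finite_setD.
- exact: below_exists.
- by move=> f f' h; exact: below_inj.
Qed.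
End ThinCone.

(** * Narrowing the cone *)

Lemma Irr_nonempty (S : set nat) : numerical_semigroup S -> exists h, Irr S h.
Proof.
move=> nsS; have [_ _ /cofinite_bound[c Sc]] := nsS.
have [//|h [_ [irrh _ _]]] := irreducible_summand nsS (Sc c.+1 (leqnSn c)).
by exists h.
Qed.

(* Take n1 of smallest slope among the highest lifts of the irreducibles: no
   irreducible leaves the cone when its lower edge is moved up to n1. *)
Lemma cone_shrink (S : set nat) (N1 N2 : nat) (K1 K2 : int) :
  numerical_semigroup S -> (0 < N2)%N -> S = cone N1 K1 N2 K2 ->
  exists (n1 : nat) (k1 : int), [/\ Irr S n1, S = cone n1 k1 N2 K2,
    K1 * n1%:Z <= N1%:Z * k1, N2%:Z * k1 <= K2 * n1%:Z
    & K2 * n1%:Z < N2%:Z * (k1 + 1)].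
Proof.
move=> nsS N20 SE; pose lift (s : nat) : int := (K2 * s%:Z %/ N2%:Z)%Z.
have liftP s : N2%:Z * lift s <= K2 * s%:Z < N2%:Z * (lift s + 1).
  exact: floorP.
have [h0 irr0] := Irr_nonempty nsS.
pose g (s : nat) : rat := (lift s)%:~R / s%:Z%:~R.
have [m irrm mmin] := finite_argmin g (finite_Irr nsS) irr0.
have [Sm m0 _] := irrm; have m_gt0 : (0 < m)%N by lia.
have lift_ge s : S s -> K1 * s%:Z <= N1%:Z * lift s.
  rewrite {1}SE => -[k [h1 h2]]; have /andP[_ h3] := liftP s.
  have kl : k < lift s + 1 by rewrite -(@ltr_pM2l _ N2%:Z); lia.
  have : N1%:Z * k <= N1%:Z * lift s by apply: ler_wpM2l; lia.
  lia.
exists m, (lift m); have /andP[lm1 lm2] := liftP m.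
split=> //; last exact: lift_ge.
apply/seteqP; split=> [s|s [k [h1 h2]]]; last first.
  rewrite SE; exists k; split=> //; rewrite -(@ler_pM2l _ m%:Z)//.
  have : N1%:Z * (lift m * s%:Z) <= N1%:Z * (m%:Z * k) by apply: ler_wpM2l.
  have : K1 * m%:Z * s%:Z <= N1%:Z * lift m * s%:Z.
    by apply: ler_wpM2r => //; exact: lift_ge.
  lia.
(* Split off an irreducible: its highest lift is above the new edge by the choice of m, and lifts
   add. *)
elim/ltn_ind: s => s IHs Ss.
have [->|/eqP s0] := eqVneq s 0%N; first by exists 0; rewrite !mulr0.
have [h [t [irrh St sE]]] := irreducible_summand nsS Ss s0.
have [_ h0' _] := irrh.
have [k [h1 h2]] := IHs t ltac:(lia) St.
exists (lift h + k); have /andP[lh1 _] := liftP h.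
have lmh : lift m * h%:Z <= m%:Z * lift h.
  have := mmin h irrh; rewrite /g ler_pdivrMr ?ltr0z// mulrAC.
  rewrite ler_pdivlMr ?ltr0z; last by lia.
  by rewrite -!intrM ler_int; lia.
rewrite sE; lia.
Qed.

(** Reflecting k to -k swaps the edges, so [cone_shrink] serves for both. *)
Lemma cone_opp (n1 k1 n2 k2 : int) :
  cone n1 k1 n2 k2 = cone n2 (- k2) n1 (- k1).
Proof. by apply/seteqP; split=> s [k [h1 h2]]; exists (- k); lia. Qed.

Lemma cone_sgtype_lt_embdim (S : set nat) (N1 N2 : nat) (K1 K2 : int) :
  numerical_semigroup S -> (0 < N2)%N -> S = cone N1 K1 N2 K2 -> ~ S 1%N ->
  (sgtype S < embdim S)%N.
Proof.
move=> nsS N20 SE nS1.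
have [n1 [k1 [irr1 SE1 _ _ c1]]] := cone_shrink nsS N20 SE.
have [_ n10 _] := irr1; have n1_gt0 : (0 < n1)%N by lia.
have [n2 [k2 [irr2 SE2 b2 c2 d2]]] :=
  cone_shrink nsS n1_gt0 (etrans SE1 (cone_opp _ _ _ _)).
have [_ n20 _] := irr2.
rewrite cone_opp opprK in SE2.
(* Over n1 the old upper edge is less than 1 above [k1], and the new one is no steeper. *)
have Dn2 : n1%:Z * - k2 - k1 * n2%:Z < n2%:Z.
  rewrite -(@ltr_pM2l _ N2%:Z)//.
  have : n2%:Z * (K2 * n1%:Z) < n2%:Z * (N2%:Z * (k1 + 1)).
    by rewrite ltr_pM2l//; lia.
  have : n1%:Z * (- K2 * n2%:Z) <= n1%:Z * (N2%:Z * k2) by apply: ler_wpM2l.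
  lia.
apply: (sgtype_lt_embdim nsS SE2 irr1 irr2) => //; last by lia.
rewrite lt_neqAle subr_ge0; apply/andP; split; last by lia.
(* If [D] = 0 the cone is a ray; its points over c and c + 1 make the slope an integer, so 1 is in
   S. *)
rewrite eq_sym subr_eq0; apply/eqP => D0; apply: nS1.
have [_ _ /cofinite_bound[c Sc]] := nsS.
have ray s : S s -> exists k : int, n1%:Z * k = k1 * s%:Z.
  rewrite {1}SE2 => -[k [h1 h2]]; exists k; apply/eqP; rewrite eq_le h1 andbT.
  rewrite -(@ler_pM2l _ n2%:Z); last by lia.
  have : n1%:Z * (n2%:Z * k) <= n1%:Z * (- k2 * s%:Z) by apply: ler_wpM2l.
  have : n1%:Z * - k2 * s%:Z = k1 * n2%:Z * s%:Z by rewrite D0.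
  lia.
have [k hk] := ray c (Sc c (leqnn c)).
have [k' hk'] := ray c.+1 (Sc c.+1 (leqnSn c)).
have kE : n1%:Z * (k' - k) = k1.
  by rewrite mulrBr hk hk' intS mulrDr mulr1 addrK.
rewrite SE2; exists (k' - k); rewrite kE !mulr1; split=> //.
rewrite -(@ler_pM2l _ n1%:Z)//.
have : n2%:Z * (n1%:Z * (k' - k)) = n2%:Z * k1 by rewrite kE.
lia.
Qed.

(** * The quotient as a cone *)

(** If P a + Q b = 1, the integer solutions of x a + y b = d s are x = d P s - b k, y = d Q s + a k;
    the edges say x >= 0 and y >= 0. *)
Lemma sgquotient_gen2_cone (a b d : nat) : coprime a b ->
  exists K1 K2 : int, sgquotient (gen2 a b) d = cone a K1 b K2.
Proof.
move=> cab.
have [P [Q PQ]] : exists P Q : int, P * a%:Z + Q * b%:Z = 1.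
  have /coprimezP[[P Q] /= PQ] : coprimez a b by [].
  by exists P, Q.
exists (- (d%:Z * Q)), (d%:Z * P); apply/seteqP; split=> s /=.
  move=> [x [y E]]; have {}E : d%:Z * s%:Z = x%:Z * a%:Z + y%:Z * b%:Z by lia.
  (* This is the parameter k of the solution (x, y). *)
  exists (y%:Z * P - x%:Z * Q).
  have E1 : a%:Z * (y%:Z * P - x%:Z * Q) = y%:Z - Q * (d%:Z * s%:Z).
    rewrite E; have : y%:Z * (P * a%:Z + Q * b%:Z) = y%:Z by rewrite PQ mulr1.
    lia.
  have E2 : b%:Z * (y%:Z * P - x%:Z * Q) = P * (d%:Z * s%:Z) - x%:Z.
    rewrite E; have : x%:Z * (P * a%:Z + Q * b%:Z) = x%:Z by rewrite PQ mulr1.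
    lia.
  lia.
move=> [k [h1 h2]].
have [x xE] : exists x : nat, d%:Z * P * s%:Z - b%:Z * k = x%:Z.
  by move: h2; rewrite -subr_ge0; case: (_ - _) => // x _; exists x.
have [y yE] : exists y : nat, a%:Z * k + d%:Z * Q * s%:Z = y%:Z.
  have : 0 <= a%:Z * k + d%:Z * Q * s%:Z by lia.
  by case: (_ + _) => // y _; exists y.
exists x, y; apply/eqP; rewrite -eqz_nat !PoszD !PoszM -xE -yE; apply/eqP.
rewrite -[LHS]mulr1 -PQ; lia.
Qed.

(** * From the type to Wilf's inequality *)

Section Wilf.
Variables (S : set nat) (F : nat).
Hypothesis nsS : numerical_semigroup S.
Hypothesis SF : forall n, (F < n)%N -> S n.

Let small := S `&` `I_F.+1.

Lemma finite_small : finite_set small.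
Proof. by apply: sub_finite_set (finite_II F.+1) => x []. Qed.

Lemma genus_add_small : (genus S + fincard small)%N = F.+1.
Proof.
have fI := finite_II F.+1; have finsm := finite_small.
have gapI : `I_F.+1 `\` small = ~` S.
  apply/seteqP; split=> x /= => [[xF nsm] Sx|nSx]; first by apply: nsm.
  split; last by case.
  by rewrite ltnNge; apply/negP => /SF.
have smI : `I_F.+1 `&` small = small by apply/seteqP; split=> x //= [].
rewrite /genus -gapI /fincard -[X in (_ + #|` fset_set X|)%N]smI.
rewrite fset_setD// (fset_setI fI finsm) addnC cardfsID.
by apply: card_fset_set; rewrite card_eqxx.
Qed.

(** Add nonzero elements of S while the sum stays a gap; this stops because gaps are at most F. *)
Lemma gap_below_PF (x : nat) : ~ S x ->
  exists s : nat, [/\ S s, (x + s <= F)%N & PF S (x + s)%N%:Z].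
Proof.
have [S0 SD _] := nsS.
have lF n : ~ S n -> (n <= F)%N.
  by move=> nSn; rewrite leqNgt; apply/negP => /SF.
have [n] := ubnP (F - x); elim: n x => // n IHn x le_n nSx.
have [[s [Ss s0 nSxs]]|mx] := pselect (exists s : nat,
  [/\ S s, s <> 0%N & ~ S (x + s)%N]).
  have := lF _ nSxs => xsF.
  have [t [St le_t Pt]] := IHn (x + s)%N ltac:(lia) nSxs.
  by exists (s + t)%N; rewrite addnA; split=> //; apply: SD.
exists 0%N; rewrite addn0; split=> //; first exact: lF.
split=> [/inZ_Posz//|s Ss s0]; apply/(inZ_Posz S (x + s)).
by apply: contrapT => nSxs; apply: mx; exists s.
Qed.

(** A gap x is recovered from the pair (x + s, s) of [gap_below_PF]. *)
Lemma genus_le_sgtype_mul : (genus S <= sgtype S * fincard small)%N.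
Proof.
have [_ _ finG] := nsS; have finP := finite_PF nsS.
apply: leq_trans (leq_fincardX finP finite_small).
pose r (x : nat) (p : int * nat) := p.1 = (x + p.2)%N%:Z.
apply: (leq_fincard_rel (r := r)) => //.
- exact/finite_setX/finite_small.
- move=> x /gap_below_PF[s [Ss le_s Ps]]; exists ((x + s)%N%:Z, s) => //.
  by split=> //; split=> //=; lia.
- by move=> x x' p _ _; rewrite /r => ->; lia.
Qed.

Lemma frobenius_le_embdim_mul : (sgtype S < embdim S)%N ->
  (F.+1 <= embdim S * fincard small)%N.
Proof.
move=> te; rewrite -genus_add_small; have := genus_le_sgtype_mul; nia.
Qed.
End Wilf.

Lemma wilf_inequality (S : set nat) : numerical_semigroup S -> ~ S 1%N ->
  (sgtype S < embdim S)%N ->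
  (genus S)%:R / (frobenius S + 1)%:~R <= 1 - (embdim S)%:R^-1 :> rat.
Proof.
move=> nsS nS1 te; have [nSf fmax] := frobeniusP nsS.
have f1 : 1 <= frobenius S by apply: (fmax 1) => /inZ_Posz.
case: (frobenius S) f1 nSf fmax => // F _ nSF fmax.
have SF n : (F < n)%N -> S n.
  move=> Fn; apply: contrapT => nSn.
  have : n%:Z <= F%:Z by apply: fmax => /inZ_Posz.
  by lia.
have := frobenius_le_embdim_mul nsS SF te; have := genus_add_small SF.
set n := fincard _ => gn le.
have e0 : (0 < embdim S)%N by lia.
(* With F + 1 = [genus S] + n, clearing denominators leaves F + 1 <= [embdim S] * n. *)
rewrite addrC -PoszD add1n -pmulrn ler_pdivrMr ?ltr0n// mulrBl mul1r.
rewrite -{1}gn natrD lerBrDr lerD2l ler_pdivrMl ?ltr0n//.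
by rewrite -natrM ler_nat.
Qed.

Theorem theorem11 (a b d : nat)
    (a_gt0 : (0 < a)%N) (b_gt0 : (0 < b)%N) (d_gt0 : (0 < d)%N)
    (cop_ab : coprime a b) (cop_ad : coprime a d) (cop_bd : coprime b d)
    (dNab : ~ gen2 a b d) :
  let S := sgquotient (gen2 a b) d in
  (sgtype S < embdim S)%N
  /\ ((genus S)%:R / (frobenius S + 1)%:~R <= 1 - (embdim S)%:R^-1 :> rat)%R.
Proof.
move=> S.
have nsS : numerical_semigroup S.
  exact/sgquotient_numerical_semigroup/gen2_numerical_semigroup.
(* Membership of 1 in S is membership of d in [gen2 a b]. *)
have nS1 : ~ S 1%N by rewrite /S /sgquotient /= muln1.
have [K1 [K2 SE]] := sgquotient_gen2_cone d cop_ab.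
have te := cone_sgtype_lt_embdim nsS b_gt0 SE nS1.
by split=> //; exact: wilf_inequality.
Qed.
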